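(* Let $P$ be the uniform distribution on the closed unit disc $D=\{(x_1,x_2)\in\mathbb R^2: x_1^2+x_2^2\le 1\}$. Assume that for every optimal set of two-means $\alpha$ for $P$, the Voronoi regions of the two points of $\alpha$ partition $D$ into two half-discs (regions bounded by a semicircle and a common diameter of $D$). Then there are uncountably many optimal sets of two-means for $P$, the quantization error is $V_2(P)=0.319873$ (decimal approximation, i.e. $|V_2(P)-0.319873|<10^{-6}$), and the two points of any optimal set of two-means are the endpoints of a diameter of the circle $x_1^2+x_2^2=\frac{16}{9\pi^2}$.
   Context: The uniform distribution on $D$ is the Borel probability measure with density $\frac1\pi$ on $D$ and $0$ elsewhere with respect to Lebesgue measure. For a Borel probability measure $P$ on $\mathbb R^d$ and $n\ge1$, the $n$th quantization error is $V_n(P)=\inf\{\int \min_{a\in\alpha}\|x-a\|^2\,dP(x):\alpha\subset\mathbb R^d,\ \mathrm{card}(\alpha)\le n\}$, where $\|\cdot\|$ is the Euclidean norm. A set $\alpha$ with $\mathrm{card}(\alpha)\le n$ attaining the infimum is called an optimal set of $n$-means; for absolutely continuous $P$ it has exactly $n$ elements. For finite $\alpha\subset\mathbb R^d$ and $a\in\alpha$, the Voronoi region of $a$ is $M(a|\alpha)=\{x\in\mathbb R^d:\|x-a\|=\min_{b\in\alpha}\|x-b\|\}$. ''Partition'' is understood up to boundaries of Lebesgue measure zero. *)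

(* Defs.v *)
From HB Require Import structures.
From mathcomp Require Import all_boot all_order all_algebra.
From mathcomp Require Import all_classical all_reals all_analysis.
From mathcomp Require Import measurable_realfun.
From mathcomp Require Import ring lra.

Set Implicit Arguments.
Unset Strict Implicit.
Unset Printing Implicit Defensive.

Import Order.TTheory GRing.Theory Num.Theory.
Import numFieldNormedType.Exports.

Local Open Scope classical_set_scope.
Local Open Scope card_scope.
Local Open Scope ring_scope.

(* The product sigma-algebra of the Borel sets of R is the Borel sigma-algebra
   of the plane. *)
Notation plane R := (measurableTypeR R * measurableTypeR R)%type.

Section plane_geometry.
Context {R : realType}.
Implicit Types (x a p q : plane R) (alpha : set (plane R)).

(* The canonical norm on a product type is the sup norm. *)
Definition enorm x : R := Num.sqrt (x.1 ^+ 2 + x.2 ^+ 2).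

Definition disc : set (plane R) := [set x | x.1 ^+ 2 + x.2 ^+ 2 <= 1].

Definition circle (s : R) : set (plane R) :=
  [set x | x.1 ^+ 2 + x.2 ^+ 2 = s].

(* Here s is the squared radius; a diameter is a chord whose midpoint is the
   centre. *)
Definition diameter_ends (s : R) p q :=
  [/\ circle s p, circle s q & p + q = 0].

(* The part of the disc on the left of the line directed from p to q; when pq
   is a diameter, [half_disc p q] and [half_disc q p] are the two closed
   half-discs which it bounds. *)
Definition half_disc p q : set (plane R) :=
  disc `&`
  [set x | 0 <= (q.1 - p.1) * (x.2 - p.2) - (q.2 - p.2) * (x.1 - p.1)].

(* For finite nonempty alpha the infimum is a minimum; it is +oo for the empty
   set. *)
Definition voronoi a alpha : set (plane R) :=
  [set x | (enorm (x - a))%:E = ereal_inf [set (enorm (x - b))%:E | b in alpha]].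

End plane_geometry.

Section quantization.
Context {R : realType} (P : probability (plane R) R).
Local Open Scope ereal_scope.

Definition distortion (alpha : set (plane R)) : \bar R :=
  \int[P]_x ereal_inf [set (enorm (x - a) ^+ 2)%:E | a in alpha].

(* Empty codebooks are allowed but have infinite distortion. *)
Definition quantization_error (n : nat) : \bar R :=
  ereal_inf [set distortion alpha | alpha in [set alpha | alpha #<= `I_n]].

Definition optimal_means (n : nat) (alpha : set (plane R)) :=
  alpha #<= `I_n /\ distortion alpha = quantization_error n.

End quantization.

Section uniform_disc.
Context (R : realType).
Local Notation mu := (@lebesgue_measure R).
Local Notation mu2 := (mu \x mu)%E.

Lemma measurable_disc : measurable (@disc R).
Proof.
have -> : @disc R = (fun x : plane R => x.1 ^+ 2 + x.2 ^+ 2) @^-1` `]-oo, 1].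
  by apply/seteqP; split => x /=; rewrite in_itv.
rewrite -[X in measurable X]setTI.
have mf : measurable_fun setT (fun x : plane R => x.1 ^+ 2 + x.2 ^+ 2).
  by apply: measurable_funD; apply: measurable_funX.
by apply: mf => //; exact: measurable_itv.
Qed.

Definition disc_pdf (x : plane R) : R := pi^-1 * \1_disc x.

Lemma disc_pdf_ge0 x : 0 <= disc_pdf x.
Proof. by rewrite mulr_ge0// invr_ge0 pi_ge0. Qed.

Lemma measurable_disc_pdf : measurable_fun setT disc_pdf.
Proof.
by apply: measurable_funM => //; apply: measurable_indic; exact: measurable_disc.
Qed.

Lemma integral_sqrt_1B2 :
  (\int[mu]_(x in `[(-1)%R, 1%R]) (2 * Num.sqrt (1 - x ^+ 2))%:E = pi%:E)%E.
Proof.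
have pi0 := pi_gt0 R; pose h : R := pi / 2.
have sh : sin h = 1 := sin_pihalf R.
have ch : cos h = 0 := cos_pihalf R.
have hE : pi = 2 * h by rewrite /h mulrC divfK// pnatr_eq0.
have h0 : - h < h by lra.
have dsin : derive1 (@sin R) = cos.
  by apply/funext => x; rewrite derive1E derive_val.
have Fsin : derivable_oo_LRcontinuous (@sin R) (- h) h.
  split.
  - by move=> x _; exact: derivable_sin.
  - by apply: cvg_at_right_filter; exact: continuous_sin.
  - by apply: cvg_at_left_filter; exact: continuous_sin.
have sNh : sin (- h) = -1 by rewrite sinN sh.
rewrite -sNh -[X in `[_, X]%classic]sh.
rewrite integration_by_substitution_increasing//; last first.
- apply: continuous_subspaceT => x.
  apply: cvgM; first exact: cvg_cst.
  apply: (@continuous_comp _ _ _ (fun x : R => 1 - x ^+ 2) Num.sqrt);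
    last exact: sqrt_continuous.
  by apply: cvgB; [exact: cvg_cst|exact: exprn_continuous].
- rewrite dsin; apply/cvg_ex; exists (cos h).
  by apply: cvg_at_left_filter; exact: continuous_cos.
- rewrite dsin; apply/cvg_ex; exists (cos (- h)).
  by apply: cvg_at_right_filter; exact: continuous_cos.
- by rewrite dsin => x _; exact: continuous_cos.
- by move=> x y xI yI xy; rewrite ltr_sin.
- exact: ltW.
transitivity (\int[mu]_(x in `[(- h)%R, h]) (2 * cos x ^+ 2)%:E)%E.
  apply: eq_integral => x; rewrite inE/= in_itv/= => xI; congr EFin.
  rewrite !fctE dsin -cos2sin2 sqrtr_sqr ger0_norm ?cos_ge0_pihalf//.
  by rewrite -mulrA -expr2.
rewrite (@continuous_FTC2 _ _ (fun x => x + sin x * cos x))//.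
- rewrite sinN cosN ch !mulr0 !addr0 -EFinB; congr EFin; lra.
- apply: continuous_subspaceT => x; apply: cvgM; first exact: cvg_cst.
  by apply: cvgM; exact: continuous_cos.
- have cF : continuous (fun x : R => x + sin x * cos x).
    move=> x; apply: cvgD; first exact: cvg_id.
    by apply: cvgM; [exact: continuous_sin|exact: continuous_cos].
  split.
  - by move=> x _; exact: ex_derive.
  - by apply: cvg_at_right_filter; exact: cF.
  - by apply: cvg_at_left_filter; exact: cF.
- move=> x _; rewrite derive1E derive_val !scalerN /GRing.scale/=.
  have := cos2Dsin2 x; nra.
Qed.

Lemma area_disc : mu2 (@disc R) = pi%:E.
Proof.
rewrite /product_measure1 -integral_sqrt_1B2 [RHS]integral_mkcond/=.
apply: eq_integral => x _ /=; rewrite patchE.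
have [xI|xI] := boolP (x \in `[(-1)%R, 1%R]%classic); last first.
  rewrite (_ : xsection _ _ = set0) ?measure0//.
  apply/seteqP; split => // y /xsectionP; rewrite /disc/= => h.
  move: xI => /negP; apply; rewrite inE/= in_itv/=; apply/andP; nra.
move: xI; rewrite inE/= in_itv/= => /andP[x1 x2].
have ge : 0 <= 1 - x ^+ 2 by nra.
have s0 := sqrtr_ge0 (1 - x ^+ 2); have s2 := sqr_sqrtr ge.
set s := Num.sqrt _ in s0 s2 *.
rewrite (_ : xsection _ _ = `[- s, s]%classic).
  rewrite lebesgue_measure_itv/= lte_fin; case: ltP => h.
    by rewrite -EFinD; congr EFin; lra.
  by congr EFin; lra.
apply/seteqP; split => y /=; rewrite in_itv/=.
  by move=> /xsectionP; rewrite /disc/= => h; apply/andP; nra.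
by move=> /andP[h1 h2]; apply/xsectionP; rewrite /disc/=; nra.
Qed.

Definition uniform_disc : set (plane R) -> \bar R :=
  fun A => (\int[mu2]_(x in A) (disc_pdf x)%:E)%E.

Let uniform_disc0 : uniform_disc set0 = 0%E.
Proof. by rewrite /uniform_disc integral_set0. Qed.

Let uniform_disc_ge0 A : (0 <= uniform_disc A)%E.
Proof. by apply: integral_ge0 => x _; rewrite lee_fin disc_pdf_ge0. Qed.

Let uniform_disc_sigma_additive : semi_sigma_additive uniform_disc.
Proof.
move=> /= F mF tF mUF; rewrite /uniform_disc; apply: cvg_toP.
  apply: ereal_nondecreasing_is_cvgn => m n mn.
  apply: lee_sum_nneg_natr => // k _ _.
  by apply: integral_ge0 => /= x Fkx; rewrite lee_fin disc_pdf_ge0.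
rewrite ge0_integral_bigcup//=.
- apply: measurable_funTS; apply: measurableT_comp => //.
  exact: measurable_disc_pdf.
- by move=> x _; rewrite lee_fin disc_pdf_ge0.
Qed.

HB.instance Definition _ := isMeasure.Build _ _ _ uniform_disc
  uniform_disc0 uniform_disc_ge0 uniform_disc_sigma_additive.

Let uniform_disc_setT : uniform_disc setT = 1%E.
Proof.
rewrite /uniform_disc /disc_pdf.
under eq_integral do rewrite EFinM.
rewrite ge0_integralZl//=; last 2 first.
- by apply/measurable_EFinP/measurable_indic; exact: measurable_disc.
- by rewrite lee_fin invr_ge0 pi_ge0.
rewrite integral_indic//; last exact: measurable_disc.
by rewrite setIT [X in (_ * X)%E]area_disc -EFinM mulVf// gt_eqF// pi_gt0.
Qed.

HB.instance Definition _ := @Measure_isProbability.Build _ _ R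
  uniform_disc uniform_disc_setT.

End uniform_disc.

Arguments uniform_disc : clear implicits.

(* Main.v *)
(* Let X be uniform on the disc and let {a, b} have midpoint s and half
   difference d = r e with |e| = 1.  Since 2 min(u, v) = u + v - |u - v|, the
   distortion of {a, b} is 1/2 + |s|^2 + r^2 - 2 r phi(t), where t = s . e and
   phi(t) = E |e . X - t|.  The marginal e . X has density
   (2/pi) sqrt(1 - u^2) for every direction e; being symmetric, it satisfies
   phi(t) = E max(|e . X|, |t|), so that phi(t) <= 4/(3 pi) + (2/pi) t^2, and
   phi(t) = |t| when |t| >= 1.  Hence phi(t)^2 - t^2 <= (4/(3 pi))^2 with
   equality only at t = 0, and the distortion is at least 1/2 - (4/(3 pi))^2,
   with equality exactly when s = 0 and r = 4/(3 pi). *)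
From HB Require Import structures.
From mathcomp Require Import all_boot all_order all_algebra.
From mathcomp Require Import all_classical all_reals all_analysis.
From mathcomp Require Import measurable_realfun.
From mathcomp Require Import ring lra.
Require Import Defs.
Import Order.TTheory GRing.Theory Num.Theory.
Import numFieldNormedType.Exports.
Local Open Scope classical_set_scope.
Local Open Scope card_scope.
Local Open Scope ring_scope.
Set Implicit Arguments.
Unset Strict Implicit.
Unset Printing Implicit Defensive.

(** * One-dimensional marginals of the uniform distribution on the disc *)

Lemma continuous_sqrt_1B2 (R : realType) :
  continuous (fun u : R => Num.sqrt (1 - u ^+ 2)).
Proof.
move=> u; apply: (@continuous_comp _ _ _ (fun u : R => 1 - u ^+ 2) Num.sqrt).
  by apply: cvgB; [exact: cvg_cst|exact: exprn_continuous].
exact: sqrt_continuous.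
Qed.

(** * Affine change of variables for Lebesgue measure on the line *)

Section affine.
Context {R : realType}.
Local Notation mu := (@lebesgue_measure R).

(** Both sides are measures in [A], so by uniqueness of Lebesgue measure it suffices to compare them
    on half-open intervals; a negative [k] swaps the two ends of the preimage. *)
Lemma lebesgue_measure_affine (k b : R) (A : set (measurableTypeR R)) : k != 0 ->
  measurable A -> mu A = (`|k|%:E * mu ((fun x => k * x + b)%R @^-1` A))%E.
Proof.
move=> k0 mA.
have mf : measurable_fun setT (fun x : measurableTypeR R => k * x + b : measurableTypeR R).
  by apply: measurable_funD => //; exact: measurable_funM.
rewrite (@lebesgue_measure_unique _ (mscale (NngNum (normr_ge0 k))
  (pushforward mu (fun x : measurableTypeR R => k * x + b : measurableTypeR R))))//.
move=> _ [[x y] _ <-] /=; rewrite lebesgue_measure_itv/= /mscale/= /pushforward.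
have [kp|kn|/eqP] := ltgtP 0 k; last by rewrite eq_sym (negbTE k0).
- rewrite (_ : _ @^-1` _ = `](x - b) / k, (y - b) / k]%classic); last first.
    apply/seteqP; split => z /=; rewrite !in_itv/= ltr_pdivrMr// ler_pdivlMr//; lra.
  rewrite lebesgue_measure_itv/= !lte_fin ltr_pM2r ?invr_gt0// ltrD2r.
  case: ifP => _; last by rewrite mule0.
  by rewrite -EFinB -EFinM gtr0_norm//; congr EFin; field.
- rewrite (_ : _ @^-1` _ = `[(y - b) / k, (x - b) / k[%classic); last first.
    apply/seteqP; split => z /=; rewrite !in_itv/= ltr_ndivlMr// ler_ndivrMr//; lra.
  rewrite lebesgue_measure_itv/= !lte_fin ltr_nM2r ?invr_lt0// ltrD2r.
  case: ifP => _; last by rewrite mule0.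
  by rewrite -EFinB -EFinM ltr0_norm//; congr EFin; field.
Qed.

Lemma ge0_integral_affine (k b : R) (f : R -> \bar R) : k != 0 ->
  measurable_fun setT f -> (forall x, 0 <= f x)%E ->
  (\int[mu]_x f x = `|k|%:E * \int[mu]_x f (k * x + b)%R)%E.
Proof.
move=> k0 mf f0.
have ma : measurable_fun setT (fun x : measurableTypeR R => k * x + b : measurableTypeR R).
  by apply: measurable_funD => //; exact: measurable_funM.
rewrite (eq_measure_integral (mscale (NngNum (normr_ge0 k))
    (pushforward mu (fun x : measurableTypeR R => k * x + b : measurableTypeR R))));
  last first.
  by move=> A mA _; exact: lebesgue_measure_affine.
rewrite ge0_integral_mscale//; congr (_ * _)%E.
by rewrite ge0_integral_pushforward.
Qed.
End affine.

(** * Reduction of integrals of functions of a linear form to the semicircle density *)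

Section uniform_disc_projection.
Context {R : realType}.
Local Notation mu := (@lebesgue_measure R).
Local Notation mu2 := (mu \x mu)%E.

(** The complement of the disc is a null set, and on measurable subsets of the disc the uniform
    distribution is planar Lebesgue measure divided by pi. *)
Lemma ge0_integral_uniform_disc (f : plane R -> \bar R) :
  measurable_fun setT f -> (forall x, 0 <= f x)%E ->
  (\int[uniform_disc R]_x f x = pi^-1%:E * \int[mu2]_x (f x * (\1_disc x)%:E))%E.
Proof.
move=> mf f0.
have pi0 : 0 <= (pi : R)^-1 by rewrite invr_ge0 pi_ge0.
have mD := @measurable_disc R.
have m1 : measurable_fun setT (fun x : plane R => (\1_(@disc R) x : R)%:E).
  by apply/measurable_EFinP/measurable_indic.
have UE (A : set (plane R)) : measurable A ->
    uniform_disc R A = ((pi^-1)%:E * mu2 (A `&` @disc R))%E.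
  move=> mA; rewrite [LHS]/uniform_disc /disc_pdf.
  under eq_integral do rewrite EFinM.
  rewrite ge0_integralZl//=; last exact: measurable_funTS.
  by rewrite integral_indic// setIC.
rewrite (@ge0_negligible_integral _ _ _ _ setT (~` @disc R))//=; last 2 first.
- exact: measurableC.
- by have := UE _ (measurableC mD); rewrite setICl measure0 mule0.
rewrite setTD setCK (eq_measure_integral (mscale (NngNum pi0) mu2)); last first.
  by move=> A mA AD; have := UE A mA; rewrite setIidl.
rewrite ge0_integral_mscale//; last exact: measurable_funTS.
by congr (_ * _)%E; rewrite integral_mkcond epatch_indic.
Qed.

(** The disc is symmetric in the diagonal: Tonelli's theorem is applied to the two sides in opposite
    orders. This makes the two coordinates interchangeable in the projection formula. *)
Lemma integral_disc_swap (f : plane R -> \bar R) :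
  measurable_fun setT f -> (forall x, 0 <= f x)%E ->
  (\int[mu2]_x (f (x.2, x.1) * (\1_disc x)%:E) = \int[mu2]_x (f x * (\1_disc x)%:E))%E.
Proof.
move=> mf f0; have mD := @measurable_disc R.
have m1 : measurable_fun setT (fun x : plane R => (\1_(@disc R) x : R)%:E).
  by apply/measurable_EFinP/measurable_indic.
rewrite fubini_tonelli1/=; last 2 first.
- apply: emeasurable_funM => //; apply: (measurableT_comp mf).
  by apply/measurable_fun_pairP; split; [exact: measurable_snd|exact: measurable_fst].
- by move=> x; rewrite mule_ge0// lee_fin.
rewrite fubini_tonelli2/=; last 2 first.
- exact: emeasurable_funM.
- by move=> x; rewrite mule_ge0// lee_fin.
rewrite /fubini_F /fubini_G/=.
apply: eq_integral => x _; apply: eq_integral => y _; congr (_ * _%:E)%E.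
by rewrite !indicE; congr (nat_of_bool _)%:R; apply/idP/idP; rewrite !inE /disc/= addrC.
Qed.

(* Substitute u = p x + q y in the inner integral, then exchange the integrals:
   the section of the disc by the line p x + q y = u has height
   2 |p| sqrt (1 - u^2). *)
Lemma integral_disc_projection_aux (g : R -> \bar R) (p q : R) : p != 0 ->
  p ^+ 2 + q ^+ 2 = 1 ->
  measurable_fun setT g -> (forall x, 0 <= g x)%E ->
  (\int[mu2]_x (g (p * x.1 + q * x.2)%R * (\1_disc x)%:E) =
   \int[mu]_(u in `[(-1)%R, 1%R]) (g u * (2 * Num.sqrt (1 - u ^+ 2))%:E))%E.
Proof.
move=> p0 pq mg g0; have mD := @measurable_disc R.
have m1 : measurable_fun setT (fun x : plane R => (\1_(@disc R) x : R)%:E).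
  by apply/measurable_EFinP/measurable_indic.
(* [S (u, y)] is the point with second coordinate y at which the linear form takes the value u. *)
pose S (x : plane R) : plane R := ((x.1 - q * x.2) / p, x.2).
pose H (x : plane R) : \bar R := (g x.1 * (\1_disc (S x))%:E)%E.
have mS : measurable_fun setT S.
  apply/measurable_fun_pairP; split; last exact: measurable_snd.
  by apply: measurable_funM => //; apply: measurable_funB => //; exact: measurable_funM.
have mH : measurable_fun setT H.
  by apply: emeasurable_funM; [exact: (measurableT_comp mg)|exact: (measurableT_comp m1)].
have H0 x : (0 <= H x)%E by rewrite mule_ge0// lee_fin.
rewrite fubini_tonelli2/=; last 2 first.
- apply: emeasurable_funM => //; apply: (measurableT_comp mg).
  by apply: measurable_funD; exact: measurable_funM.
- by move=> x; rewrite mule_ge0// lee_fin.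
transitivity (\int[mu]_y (`|p|^-1%:E * \int[mu]_u H (u, y)))%E.
  apply: eq_integral => y _; rewrite /fubini_G.
  rewrite (ge0_integral_affine (q * y) p0 (f := fun u => H (u, y)))//; last first.
    exact: (measurableT_comp mH).
  rewrite muleA -EFinM mulVf ?normr_eq0// mul1e.
  by apply: eq_integral => x _; rewrite /H /S/= addrK (mulrC p) mulfK.
rewrite ge0_integralZl//=; last 2 first.
- exact: measurable_fun_fubini_tonelli_G.
- by move=> y _; exact: integral_ge0.
rewrite -fubini_tonelli//.
rewrite [X in (_ * X)%E](_ : _ =
    (`|p|%:E * \int[mu]_(u in `[(-1)%R, 1%R]) (g u * (2 * Num.sqrt (1 - u ^+ 2))%:E))%E).
  by rewrite muleA -EFinM mulVf ?normr_eq0// mul1e.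
rewrite -ge0_integralZl//=; last 2 first.
- apply: emeasurable_funM; first exact: measurable_funTS.
  apply/measurable_EFinP/measurable_funM => //; apply: measurable_funTS.
  apply: continuous_measurable_fun; exact: continuous_sqrt_1B2.
- by move=> u _; rewrite mule_ge0// lee_fin mulr_ge0// sqrtr_ge0.
rewrite [RHS]integral_mkcond; apply: eq_integral => u _; rewrite patchE.
(* Completing the square in y, with p^2 + q^2 = 1: the section at u is empty for |u| > 1, and
   otherwise it is the interval with centre q u and half-length |p| sqrt (1 - u^2). *)
have SE y : p ^+ 2 * (((u - q * y) / p) ^+ 2 + y ^+ 2 - 1) =
    (y - q * u) ^+ 2 - p ^+ 2 * (1 - u ^+ 2).
  transitivity ((u - q * y) ^+ 2 + p ^+ 2 * y ^+ 2 - p ^+ 2); first by field.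
  have -> : p ^+ 2 = 1 - q ^+ 2 by rewrite -pq addrK.
  by ring.
have p2 : 0 < p ^+ 2 by rewrite exprn_even_gt0.
have inS y : disc (S (u, y)) = ((y - q * u) ^+ 2 <= p ^+ 2 * (1 - u ^+ 2)) :> Prop.
  by rewrite /disc/= -subr_le0 -(pmulr_rle0 _ p2) SE subr_le0.
rewrite /H/= ge0_integralZl//=; last first.
  by apply: (measurableT_comp (measurableT_comp m1 mS)); exact: pair1_measurable.
rewrite muleCA; case: ifPn => [|uI]; last first.
  rewrite integral0_eq ?mule0// => y _; rewrite indicE memNset//= inS => h.
  move: uI => /negP; apply; rewrite inE/= in_itv/=.
  have : 0 <= p ^+ 2 * (1 - u ^+ 2) by exact: le_trans (sqr_ge0 _) h.
  by rewrite pmulr_rge0// => u2; apply/andP; nra.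
rewrite inE/= in_itv/= => uI; congr (_ * _)%E.
have u2 : 0 <= 1 - u ^+ 2 by nra.
have s0 := sqrtr_ge0 (1 - u ^+ 2); have s2 := sqr_sqrtr u2.
set s := Num.sqrt _ in s0 s2 *.
pose I := `[q * u - `|p| * s, q * u + `|p| * s]%classic : set (measurableTypeR R).
rewrite (eq_integral (fun y => (\1_I y)%:E)); last first.
  have IE y : ((y - q * u) ^+ 2 <= p ^+ 2 * (1 - u ^+ 2)) =
      (`|y - q * u| <= `|p| * s).
    rewrite -s2 -[p ^+ 2](real_normK (num_real p)) -exprMn.
    rewrite -[in LHS](real_normK (num_real (y - _))).
    by rewrite ler_sqr// nnegrE mulr_ge0.
  move=> y _; congr EFin; rewrite !indicE; congr (nat_of_bool _)%:R.
  by apply/idP/idP; rewrite !inE inS /I/= in_itv/= -ler_distl IE.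
have ps : 0 <= `|p| * s by rewrite mulr_ge0.
rewrite integral_indic//=; last exact: measurable_itv.
rewrite setIT /I lebesgue_measure_itv/= lte_fin -EFinM.
by case: ltP => h; rewrite -?EFinB; congr EFin; lra.
Qed.

(** If p = 0 then q is nonzero, and exchanging the coordinates reduces to the previous case. *)
Lemma integral_disc_projection (g : R -> \bar R) (p q : R) :
  p ^+ 2 + q ^+ 2 = 1 ->
  measurable_fun setT g -> (forall x, 0 <= g x)%E ->
  (\int[mu2]_x (g (p * x.1 + q * x.2)%R * (\1_disc x)%:E) =
   \int[mu]_(u in `[(-1)%R, 1%R]) (g u * (2 * Num.sqrt (1 - u ^+ 2))%:E))%E.
Proof.
move=> pq mg g0; have [p0|p0] := eqVneq p 0; last exact: integral_disc_projection_aux.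
rewrite -(@integral_disc_projection_aux _ q p)//; last 2 first.
- by apply/eqP => q0; move: pq; rewrite p0 q0; lra.
- by rewrite addrC.
rewrite -integral_disc_swap//; last first.
  by apply: (measurableT_comp mg); apply: measurable_funD; exact: measurable_funM.
by apply: eq_integral => x _; rewrite addrC.
Qed.

Lemma ge0_integral_uniform_disc_projection (g : R -> \bar R) (p q : R) :
  p ^+ 2 + q ^+ 2 = 1 ->
  measurable_fun setT g -> (forall x, 0 <= g x)%E ->
  (\int[uniform_disc R]_x g (p * x.1 + q * x.2)%R =
   pi^-1%:E * \int[mu]_(u in `[(-1)%R, 1%R]) (g u * (2 * Num.sqrt (1 - u ^+ 2))%:E))%E.
Proof.
move=> pq mg g0; rewrite -(integral_disc_projection pq)// ge0_integral_uniform_disc//.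
by apply: (measurableT_comp mg); apply: measurable_funD; exact: measurable_funM.
Qed.
End uniform_disc_projection.

(** * Moments of the semicircle density *)

Section semicircle.
Context {R : realType}.
Local Notation mu := (@lebesgue_measure R).
Implicit Types (c d t u a b : R).

(** The integrand is the derivative of (c + d u) (1 - u^2)^(3/2). Differentiation is needed only
    inside the interval, since the square root is not differentiable at -1 and 1. Choices of c and d
    yield the absolute and the second moment. *)
Lemma integral_semicircle_poly c d a b : -1 <= a -> a < b -> b <= 1 ->
  let F u := (c + d * u) * (1 - u ^+ 2) * Num.sqrt (1 - u ^+ 2) in
  (\int[mu]_(u in `[a, b])
     ((d * (1 - u ^+ 2) - 3 * u * (c + d * u)) * Num.sqrt (1 - u ^+ 2))%:E =
   (F b - F a)%:E)%E.
Proof.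
move=> a1 ab b1 F.
have cs := @continuous_sqrt_1B2 R.
have c1 : continuous (fun u => 1 - u ^+ 2 : R).
  by move=> u; apply: cvgB; [exact: cvg_cst|exact: exprn_continuous].
have cl : continuous (fun u => c + d * u : R).
  by move=> u; apply: cvgD; [exact: cvg_cst|apply: cvgM; [exact: cvg_cst|exact: cvg_id]].
have cF : continuous F.
  by move=> u; apply: cvgM; [apply: cvgM; [exact: cl|exact: c1]|exact: cs].
have dF u : u \in `]a, b[%R -> is_derive u 1 F
    ((d * (1 - u ^+ 2) - 3 * u * (c + d * u)) * Num.sqrt (1 - u ^+ 2)).
  rewrite in_itv/= => /andP[au ub].
  have u2 : 0 < 1 - u ^+ 2 by nra.
  have s2 := sqr_sqrtr (ltW u2).
  have s0 : 0 < Num.sqrt (1 - u ^+ 2) by rewrite sqrtr_gt0.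
  have ds : is_derive u 1 (fun u : R => Num.sqrt (1 - u ^+ 2)) (- u / Num.sqrt (1 - u ^+ 2)).
    have dsq := is_derive1_sqrt u2.
    have d1 : is_derive u 1 (fun u : R => 1 - u ^+ 2) (- (2 * u)).
      by apply: is_derive_eq; rewrite /GRing.scale/=; ring.
    have dc := @is_derive1_comp _ Num.sqrt (fun u : R => 1 - u ^+ 2) _ _ _ dsq d1.
    rewrite /comp in dc; apply: (is_derive_eq dc).
    by rewrite /GRing.scale/=; field; rewrite gt_eqF.
  apply: is_derive_eq; rewrite /GRing.scale/=.
  set s := Num.sqrt _ in s2 s0 *.
  have -> : (c + d * u) * (1 - u ^+ 2) * (- u / s) = - ((c + d * u) * u * s).
    by rewrite -s2; field; rewrite gt_eqF.
  by ring.
rewrite (@continuous_FTC2 _ _ F)//.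
- apply: continuous_subspaceT => u; apply: cvgM; last exact: cs.
  apply: cvgB; first by apply: cvgM; [exact: cvg_cst|exact: c1].
  apply: cvgM; last exact: cl.
  by apply: cvgM; [exact: cvg_cst|exact: cvg_id].
- split.
  + by move=> u /dF [].
  + by apply: cvg_at_right_filter; exact: cF.
  + by apply: cvg_at_left_filter; exact: cF.
- by move=> u /dF [_ <-]; rewrite derive1E.
Qed.

(** With c = 0 and d = 1 the integrand is (1 - 4 u^2) sqrt (1 - u^2) and the primitive vanishes at
    both ends, so twice the second moment equals half the total mass pi. *)
Lemma integral_semicircle_sqr :
  (\int[mu]_(u in `[(-1)%R, 1%R]) (u ^+ 2 * (2 * Num.sqrt (1 - u ^+ 2)))%:E = (pi / 4)%:E)%E.
Proof.
have cs := @continuous_sqrt_1B2 R.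
have N11 : (-1 : R) < 1 by lra.
have := integral_semicircle_poly 0 1 (lexx _) N11 (lexx _).
pose f u := 2^-1 * (2 * Num.sqrt (1 - u ^+ 2)) : R.
pose g u := 2 * (u ^+ 2 * (2 * Num.sqrt (1 - u ^+ 2))) : R.
under eq_integral => u _.
  rewrite (_ : (_ * _) = f u - g u); last by rewrite /f /g; field.
  rewrite EFinB; over.
have cf : continuous f.
  by move=> u; apply: cvgM; [exact: cvg_cst|apply: cvgM; [exact: cvg_cst|exact: cs]].
have cu : continuous (fun u => u ^+ 2 * (2 * Num.sqrt (1 - u ^+ 2)) : R).
  by move=> u; apply: cvgM; [exact: exprn_continuous|apply: cvgM; [exact: cvg_cst|exact: cs]].
have cg : continuous g by move=> u; apply: cvgM; [exact: cvg_cst|exact: cu].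
have int h : continuous h -> mu.-integrable `[(-1 : R), 1] (EFin \o h).
  move=> ch; apply: continuous_compact_integrable; first exact: segment_compact.
  exact: continuous_subspaceT.
rewrite integralB_EFin//; [|exact: int|exact: int].
rewrite /f /g.
under eq_integral do rewrite EFinM.
rewrite integralZl//; last first.
  by apply: int => u; apply: cvgM; [exact: cvg_cst|exact: cs].
rewrite integral_sqrt_1B2.
under [X in (_ - X)%E]eq_integral do rewrite EFinM.
rewrite integralZl//; last exact: int.
have /fineK <- : (\int[mu]_(u in `[(-1)%R, 1%R])
    (u ^+ 2 * (2 * Num.sqrt (1 - u ^+ 2)))%:E)%E \is a fin_num.
  by apply: integrable_fin_num => //; exact: int.
rewrite -!EFinM -EFinB => -[] E; congr EFin.
by move: E; rewrite sqrrN expr1n subrr !mulr0 !mul0r; lra.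
Qed.

(** Splitting at 0 gives two instances of the primitive with d = 0 and c = 2/3 or -2/3, each
    contributing 2/3. *)
Lemma integral_semicircle_norm :
  (\int[mu]_(u in `[(-1)%R, 1%R]) (`|u| * (2 * Num.sqrt (1 - u ^+ 2)))%:E = (4 / 3)%:E)%E.
Proof.
have cs := @continuous_sqrt_1B2 R.
pose f u := `|u| * (2 * Num.sqrt (1 - u ^+ 2)) : R.
have mf D : measurable_fun D (EFin \o f).
  apply: measurable_funTS; apply/measurable_EFinP; apply: continuous_measurable_fun => u.
  apply: cvgM; first exact: norm_continuous.
  by apply: cvgM; [exact: cvg_cst|exact: cs].
have s0 u : 0 <= Num.sqrt (1 - u ^+ 2) by exact: sqrtr_ge0.
rewrite (@itv_bndbnd_setU _ _ (BLeft (-1 : R)) (BRight (0 : R)) (BRight (1 : R))) ?bnd_simp//.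
rewrite ge0_integral_setU//=; last 2 first.
- exact: mf.
- apply/disj_setPS => u /=; rewrite !in_itv/=; lra.
rewrite integral_itv_obnd_cbnd; last exact: mf.
have N10 : (-1 : R) < 0 by lra.
rewrite (_ : (4 / 3) = 2 / 3 + 2 / 3); last by field.
rewrite EFinD; congr (_ + _)%E.
- transitivity (\int[mu]_(u in `[(-1)%R, 0%R])
      ((0 * (1 - u ^+ 2) - 3 * u * (2 / 3 + 0 * u)) * Num.sqrt (1 - u ^+ 2))%:E)%E.
    apply: eq_integral => u; rewrite inE/= in_itv/= => /andP[_ u0].
    by rewrite ler0_norm//; congr EFin; field.
  rewrite integral_semicircle_poly//; congr EFin.
  by rewrite sqrrN !expr1n expr0n/= subr0 sqrtr1 subrr !mulr0 mul0r; field.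
- transitivity (\int[mu]_(u in `[0%R, 1%R])
      ((0 * (1 - u ^+ 2) - 3 * u * (- (2 / 3) + 0 * u)) * Num.sqrt (1 - u ^+ 2))%:E)%E.
    apply: eq_integral => u; rewrite inE/= in_itv/= => /andP[u0 _].
    by rewrite ger0_norm//; congr EFin; field.
  rewrite integral_semicircle_poly//.
  congr EFin.
  by rewrite !expr1n expr0n/= subr0 sqrtr1 subrr !mulr0 mul0r; field.
Qed.

(** The tent is dominated by the sum of two linear ramps, on [-t, 0] and on [0, t], each of area t^2
    / 2. The ramps overlap at 0, which is harmless for an upper bound. *)
Lemma integral_tent t : 0 <= t ->
  (\int[mu]_u (Num.max (t - `|u|) 0)%:E <= (t ^+ 2)%:E)%E.
Proof.
rewrite le_eqVlt => /predU1P[<-|t0].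
  rewrite integral0_eq ?expr0n// => u _.
  by rewrite sub0r; congr EFin; apply/max_idPr; rewrite oppr_le0.
have Nt0 : - t < 0 by lra.
have ramp d a b : a < b -> (\int[mu]_(u in `[a, b]) (t + d * u)%:E =
     (t * (b - a) + d * (b ^+ 2 - a ^+ 2) / 2)%:E)%E.
  move=> ab; pose F u := t * u + d * (u ^+ 2 / 2).
  have dF u : is_derive u 1 F (t + d * u).
    by apply: is_derive_eq; rewrite /GRing.scale/=; field.
  have cF : continuous F.
    move=> u; apply/differentiable_continuous/derivable1_diffP.
    by case: (dF u).
  rewrite (@continuous_FTC2 _ _ F)//.
  - by rewrite -EFinB; congr EFin; rewrite /F; field.
  - apply: continuous_subspaceT => u; apply: cvgD; first exact: cvg_cst.
    by apply: cvgM; [exact: cvg_cst|exact: cvg_id].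
  - split.
    + by move=> u _; case: (dF u).
    + by apply: cvg_at_right_filter; exact: cF.
    + by apply: cvg_at_left_filter; exact: cF.
  - by move=> u _; rewrite derive1E; case: (dF u).
have mr d (a b : R) : measurable_fun setT ((fun u => (t + d * u)%:E) \_ `[a, b]%classic).
  apply/(measurable_restrictT _ _).1 => //; apply: measurable_funTS.
  by apply/measurable_EFinP; apply: measurable_funD => //; exact: measurable_funM.
have r0 d a b : (forall u, a <= u <= b -> 0 <= t + d * u) ->
    forall u : R, (0 <= ((fun u => (t + d * u)%:E) \_ `[a, b]%classic) u)%E.
  move=> h u; rewrite patchE; case: ifPn => //; rewrite inE/= in_itv/= => /h.
  by rewrite lee_fin.
have p1 : forall u, - t <= u <= 0 -> 0 <= t + 1 * u by move=> u; lra.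
have p2 : forall u, 0 <= u <= t -> 0 <= t + -1 * u by move=> u; lra.
apply: (@le_trans _ _ (\int[mu]_u (((fun u => (t + 1 * u)%:E) \_ `[(- t)%R, 0%R]%classic) u +
    ((fun u => (t + -1 * u)%:E) \_ `[0%R, t]%classic) u))%E).
  apply: ge0_le_integral => //.
  - by move=> u _; rewrite lee_fin le_max lexx orbT.
  - apply/measurable_EFinP; apply: measurable_maxr => //.
    by apply: measurable_funB => //; exact: measurableT_comp.
  - by apply: emeasurable_funD; exact: mr.
  move=> u _.
  have [ut|tu] := leP `|u| t; last first.
    rewrite (_ : Num.max _ _ = 0); last by apply/max_idPr; lra.
    by apply: adde_ge0; exact: r0.
  rewrite (_ : Num.max _ _ = t - `|u|); last by apply/max_idPl; lra.
  move: ut; have [u0|u0] := leP u 0 => ut.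
  - apply: (@le_trans _ _ (((fun u => (t + 1 * u)%:E) \_ `[(- t)%R, 0%R]%classic) u)).
      rewrite patchE ifT ?lee_fin; first by rewrite ler0_norm//; lra.
      by rewrite inE/= in_itv/= u0 andbT; move: ut; rewrite ler0_norm//; lra.
    by rewrite leeDl//; exact: r0.
  - apply: (@le_trans _ _ (((fun u => (t + -1 * u)%:E) \_ `[0%R, t]%classic) u)).
      rewrite patchE ifT ?lee_fin; first by rewrite gtr0_norm//; lra.
      by rewrite inE/= in_itv/= ltW//=; move: ut; rewrite gtr0_norm.
    by rewrite leeDr//; exact: r0.
rewrite ge0_integralD//; last 4 first.
- by move=> u _; exact: r0.
- exact: mr.
- by move=> u _; exact: r0.
- exact: mr.
rewrite -!integral_mkcond !ramp// -EFinD lee_fin; lra.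
Qed.
End semicircle.

(** * Moments of a unit linear form X under the uniform distribution *)

Section projected_moments.
Context {R : realType}.
Local Notation mu := (@lebesgue_measure R).
Local Notation P := (uniform_disc R).
Variables p q : R.
Hypothesis pq : p ^+ 2 + q ^+ 2 = 1.
Local Notation X x := (p * x.1 + q * x.2).

Let measurable_projection (p' q' : R) :
  measurable_fun setT (fun x : plane R => p' * x.1 + q' * x.2).
Proof. by apply: measurable_funD; exact: measurable_funM. Qed.

(** The marginal is the same for (p, q) and (-p, -q), so X and -X have the same law and g may be
    replaced by its even part h. *)
Lemma integral_projection_sym (g h : R -> R) :
  measurable_fun setT g -> measurable_fun setT h ->
  (forall u, 0 <= g u) -> (forall u, 0 <= h u) ->
  (forall u, g u + g (- u) = 2 * h u) ->
  (\int[P]_x (g (X x))%:E = \int[P]_x (h (X x))%:E)%E.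
Proof.
move=> mg mh g0 h0 gh.
have Npq : (- p) ^+ 2 + (- q) ^+ 2 = 1 by rewrite !sqrrN.
have mEg : measurable_fun setT (EFin \o g) by exact/measurable_EFinP.
have gX : (\int[P]_x (g (- X x))%:E = \int[P]_x (g (X x))%:E)%E.
  have := @ge0_integral_uniform_disc_projection _ (EFin \o g) _ _ pq mEg g0.
  rewrite -(@ge0_integral_uniform_disc_projection _ (EFin \o g) _ _ Npq mEg g0) => ->.
  by apply: eq_integral => x _ /=; rewrite opprD !mulNr.
have mE (f : R -> R) (p' q' : R) : measurable_fun setT f ->
    measurable_fun setT (fun x : plane R => (f (p' * x.1 + q' * x.2))%:E).
  by move=> mf; apply/measurable_EFinP; apply: (measurableT_comp mf).
have : (2%:E * \int[P]_x (g (X x))%:E = 2%:E * \int[P]_x (h (X x))%:E)%E.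
  transitivity (\int[P]_x ((g (X x))%:E + (g (- X x))%:E))%E.
    rewrite ge0_integralD//; last 4 first.
    - by move=> x _; rewrite lee_fin.
    - exact: mE.
    - by move=> x _; rewrite lee_fin.
    - under eq_fun do rewrite opprD -!mulNr; exact: mE.
    by rewrite gX -mule2n mule_natl.
  rewrite -ge0_integralZl//; last 2 first.
  - exact: mE.
  - by move=> x _; rewrite lee_fin.
  by apply: eq_integral => x _; rewrite -EFinD gh EFinM.
move=> /(congr1 (fun z => (2^-1)%:E * z)%E).
by rewrite !muleA -EFinM mulVf// !mul1e.
Qed.

Let EX (g : R -> R) : measurable_fun setT g -> (forall u, 0 <= g u) ->
  (\int[P]_x (g (X x))%:E = pi^-1%:E *
     \int[mu]_(u in `[(-1)%R, 1%R]) (g u * (2 * Num.sqrt (1 - u ^+ 2)))%:E)%E.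
Proof.
move=> mg g0; have mEg : measurable_fun setT (EFin \o g) by exact/measurable_EFinP.
rewrite (@ge0_integral_uniform_disc_projection _ (EFin \o g) _ _ pq mEg g0).
by congr (_ * _)%E; apply: eq_integral.
Qed.

Let w (u : R) := 2 * Num.sqrt (1 - u ^+ 2).
Let w0 u : 0 <= w u. Proof. by rewrite mulr_ge0// sqrtr_ge0. Qed.
Let mw D : measurable_fun D (fun u => w u : R).
Proof.
apply: measurable_funTS; apply: measurable_funM => //.
by apply: continuous_measurable_fun; exact: continuous_sqrt_1B2.
Qed.

(** The even part of (u - c)^2 is u^2 + c^2, and X has second moment (pi / 4) / pi. *)
Lemma integral_projection_sqr c : (\int[P]_x ((X x - c) ^+ 2)%:E = (1 / 4 + c ^+ 2)%:E)%E.
Proof.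
have pi0 : pi != 0 :> R by rewrite gt_eqF// pi_gt0.
rewrite (@integral_projection_sym (fun u => (u - c) ^+ 2) (fun u => u ^+ 2 + c ^+ 2))//.
- rewrite (EX (g := fun u => u ^+ 2 + c ^+ 2))//; last 2 first.
  + by apply: measurable_funD => //; exact: measurable_funX.
  + by move=> u; rewrite addr_ge0 ?sqr_ge0.
  under eq_integral do rewrite mulrDl EFinD (EFinM (c ^+ 2)).
  rewrite ge0_integralD//; last 4 first.
  + by move=> u _; rewrite lee_fin mulr_ge0 ?sqr_ge0// w0.
  + by apply/measurable_EFinP; apply: measurable_funM => //; exact: mw.
  + by move=> u _; rewrite lee_fin mulr_ge0 ?sqr_ge0// w0.
  + by apply: emeasurable_funM => //; apply/measurable_EFinP; exact: mw.
  rewrite integral_semicircle_sqr ge0_integralZl//; last 2 first.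
  + by apply/measurable_EFinP; exact: mw.
  + by rewrite lee_fin sqr_ge0.
  rewrite integral_sqrt_1B2 -!EFinM; congr EFin.
  by move: (pi : R) pi0 => x x0; field.
- by apply: measurable_funX; exact: measurable_funB.
- by apply: measurable_funD => //; exact: measurable_funX.
- by move=> u; rewrite sqr_ge0.
- by move=> u; rewrite addr_ge0 ?sqr_ge0.
- by move=> u; ring.
Qed.

Lemma integral_projection_norm : (\int[P]_x `|X x|%:E = (4 / (3 * pi))%:E)%E.
Proof.
have pi0 : pi != 0 :> R by rewrite gt_eqF// pi_gt0.
rewrite (EX (g := Num.norm))// integral_semicircle_norm -EFinM.
by congr EFin; move: (pi : R) pi0 => x x0; field.
Qed.

(* Averaging over the sign of X replaces |X - t| by max (|X|, |t|). *)
Lemma integral_projection_normB t :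
  (\int[P]_x `|X x - t|%:E = pi^-1%:E * \int[mu]_(u in `[(-1)%R, 1%R])
     (Num.max `|u| `|t| * (2 * Num.sqrt (1 - u ^+ 2)))%:E)%E.
Proof.
have mm : measurable_fun setT (fun u : R => Num.max `|u| `|t|).
  by apply: measurable_maxr.
have m0 (u : R) : 0 <= Num.max `|u| `|t| by rewrite le_max normr_ge0.
rewrite (@integral_projection_sym (fun u => `|u - t|) (fun u => Num.max `|u| `|t|))//.
- by rewrite (EX (g := fun u => Num.max `|u| `|t|)).
- by apply: measurableT_comp => //; exact: measurable_funB.
- move=> u; rewrite -[- u - t]opprD normrN.
  case: (ler0P (u - t)) => h1; case: (ler0P (u + t)) => h2; case: (ler0P u) => h3;
    by case: (ler0P t) => h4; case: leP => h5; lra.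
Qed.

(** Write max (|u|, |t|) as |u| plus the positive part of |t| - |u|. The first term gives the
    absolute moment; in the second the weight is at most 2, and the tent has area at most t^2. *)
Lemma integral_projection_normB_le t : 
  (\int[P]_x `|X x - t|%:E <= (4 / (3 * pi) + 2 / pi * t ^+ 2)%:E)%E.
Proof.
have pi0 : 0 < pi :> R := pi_gt0 R.
rewrite integral_projection_normB.
have mt : measurable_fun setT (fun u : R => Num.max (`|t| - `|u|) 0).
  by apply: measurable_maxr => //; apply: measurable_funB => //; exact: measurableT_comp.
have mtw D : measurable_fun D (fun u : R => (Num.max (`|t| - `|u|) 0 * w u)%:E).
  apply/measurable_EFinP; apply: measurable_funM; last exact: mw.
  exact: measurable_funTS.
have t0 (u : R) : 0 <= Num.max (`|t| - `|u|) 0 by rewrite le_max lexx orbT.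
under eq_integral => u _.
  rewrite (_ : Num.max `|u| `|t| = `|u| + Num.max (`|t| - `|u|) 0); last first.
    by case: (leP `|u| `|t|) => h; case: (leP (`|t| - `|u|) 0) => h1; lra.
  rewrite mulrDl EFinD; over.
rewrite ge0_integralD//=; last 2 first.
- by apply/measurable_EFinP; apply: measurable_funM; [exact: measurable_funTS|exact: mw].
- exact: mtw.
rewrite integral_semicircle_norm.
have : (\int[mu]_(u in `[(-1)%R, 1%R]) (Num.max (`|t| - `|u|) 0 * w u)%:E <=
    2%:E * (`|t| ^+ 2)%:E)%E.
  apply: le_trans (lee_wpmul2l _ (integral_tent (normr_ge0 t))); last by rewrite lee_fin.
  rewrite -ge0_integralZl//; last exact/measurable_EFinP.
  have mt2 D : measurable_fun D (fun u : R => (2%:E * (Num.max (`|t| - `|u|) 0)%:E)%E).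
    apply: measurable_funTS; under eq_fun do rewrite -EFinM.
    by apply/measurable_EFinP; exact: measurable_funM.
  apply: (le_trans _ (@ge0_subset_integral _ _ _ mu `[(-1)%R, 1%R]%classic setT
    _ _ _ _ _ _)) => //.
  - apply: ge0_le_integral => //.
    + by move=> u _; rewrite lee_fin mulr_ge0// w0.
    + exact: mtw.
    + exact: mt2.
    + move=> u _; rewrite -EFinM lee_fin mulrC ler_wpM2r// /w ger_pMr//.
      by rewrite -[leRHS]sqrtr1 ler_wsqrtr// gerBl sqr_ge0.
  - exact: mt2.
move=> H.
have pV : (0 <= pi^-1%:E :> \bar R)%E by rewrite lee_fin invr_ge0 ltW.
apply: (le_trans (lee_wpmul2l pV (leeD2l _ H))).
rewrite -!EFinM lee_fin real_normK ?num_real// le_eqVlt; apply/orP; left.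
by apply/eqP; move: (pi : R) pi0 => x x0; field; rewrite gt_eqF.
Qed.

(** On [-1, 1] the maximum of |u| and |t| is then constantly |t|, and the weight has mass pi. *)
Lemma integral_projection_normB_ge1 t : 1 <= `|t| ->
  (\int[P]_x `|X x - t|%:E = `|t|%:E)%E.
Proof.
have pi0 : pi != 0 :> R by rewrite gt_eqF// pi_gt0.
move=> t1; rewrite integral_projection_normB.
under eq_integral => u uI.
  move: uI; rewrite inE/= in_itv/= -ler_norml => u1.
  rewrite (max_idPr _) ?(le_trans u1)// EFinM; over.
rewrite ge0_integralZl//; last by apply/measurable_EFinP; exact: mw.
by rewrite integral_sqrt_1B2 -!EFinM; congr EFin; move: (pi : R) pi0 => x x0; field.
Qed.

End projected_moments.

(** * Numerical bounds on pi *)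

Section pi_bounds.
Context {R : realType}.
Implicit Types x : R.

Let nondecreasing_from0 (f df : R -> R) x : 0 <= x ->
  (forall u : R, is_derive u 1 f (df u)) -> (forall u, 0 <= df u) -> f 0 <= f x.
Proof.
rewrite le_eqVlt => /predU1P[<-//|x0] dfE df0.
have cf : {within `[0, x], continuous f}.
  apply: derivable_within_continuous => u _; by case: (dfE u).
have [c _ E] := MVT x0 (fun u _ => dfE u) cf.
by rewrite -subr_ge0 E mulr_ge0// subr0 ltW.
Qed.

(** By the finite geometric sum, the difference of the two sides has derivative u^8 / (1 + u^2); the
    companion upper bound leaves u^10 / (1 + u^2). *)
Lemma atan_ge x : 0 <= x -> x - x ^+ 3 / 3 + x ^+ 5 / 5 - x ^+ 7 / 7 <= atan x.
Proof.
move=> x0.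
pose f u : R := atan u - (u - u ^+ 3 / 3 + u ^+ 5 / 5 - u ^+ 7 / 7).
have : f 0 <= f x.
  apply: (@nondecreasing_from0 _ (fun u => u ^+ 8 / (1 + u ^+ 2))) => // u.
  - have u0 : 1 + u ^+ 2 != 0 by rewrite gt_eqF// ltr_pwDl// sqr_ge0.
    by apply: is_derive_eq; rewrite /GRing.scale/=; field.
  - by rewrite divr_ge0// ?addr_ge0 ?sqr_ge0 ?exprn_even_ge0.
rewrite /f atan0; lra.
Qed.

Lemma atan_le x : 0 <= x ->
  atan x <= x - x ^+ 3 / 3 + x ^+ 5 / 5 - x ^+ 7 / 7 + x ^+ 9 / 9.
Proof.
move=> x0.
pose f u : R := u - u ^+ 3 / 3 + u ^+ 5 / 5 - u ^+ 7 / 7 + u ^+ 9 / 9 - atan u.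
have : f 0 <= f x.
  apply: (@nondecreasing_from0 _ (fun u => u ^+ 10 / (1 + u ^+ 2))) => // u.
  - have u0 : 1 + u ^+ 2 != 0 by rewrite gt_eqF// ltr_pwDl// sqr_ge0.
    by apply: is_derive_eq; rewrite /GRing.scale/=; field.
  - by rewrite divr_ge0// ?addr_ge0 ?sqr_ge0 ?exprn_even_ge0.
rewrite /f atan0; lra.
Qed.

(** Doubling the angle twice takes the tangent from 1/5 to 5/12 to 120/119, and subtracting atan
    (1/239) makes it 1. Bounding each arctangent by its argument keeps all angles in the range where
    tan is defined and can be inverted. *)
Lemma Machin_formula : pi / 4 = 4 * atan 5^-1 - atan 239^-1 :> R.
Proof.
pose a : R := atan 5^-1; pose c : R := atan 239^-1.
have p2 := pihalf_ge1 R.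
have a0 : 0 < a by rewrite -(atan0 R) lt_atan.
have c0 : 0 < c by rewrite -(atan0 R) lt_atan.
have a1 : a <= 5^-1.
  apply: (le_trans (atan_le _)) => //; lra.
have c1 : c <= 239^-1.
  apply: (le_trans (atan_le _)) => //; lra.
have cn0 u : - (pi / 2) < u < pi / 2 -> cos u != 0 :> R.
  by move=> h; rewrite gt_eqF// cos_gt0_pihalf.
have ta : tan a = 5^-1 by rewrite atanK.
have tc : tan c = 239^-1 by rewrite atanK.
have t2 : tan (a + a) = 5 / 12.
  rewrite tanD ?ta; [by field| |]; apply: cn0; apply/andP; lra.
have t4 : tan (a + a + (a + a)) = 120 / 119.
  rewrite tanD ?t2; [by field| |]; apply: cn0; apply/andP; lra.
have t1 : tan (a + a + (a + a) + - c) = 1.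
  rewrite tanD ?tanN ?t4 ?tc; [by field| |]; apply: cn0; apply/andP; lra.
rewrite -atan1 -[X in atan X = _]t1 tanK.
  by rewrite -/a -/c; ring.
by rewrite in_itv/=; apply/andP; lra.
Qed.

(** The truncation error 5^-9 / 9 at 1/5 enters pi with factor 16, a total below 10^-6. The upper
    bound is 3.141597 because 3.1416 would not yield the lower estimate 0.180126 for 16 / (9
    pi^2). *)
Lemma pi_bounds :
  314 / 10 ^+ 2 + 159 / 10 ^+ 5 < (pi : R) < 314 / 10 ^+ 2 + 160 / 10 ^+ 5 - 3 / 10 ^+ 6.
Proof.
have := Machin_formula.
have h5 : 0 <= 5^-1 :> R by [].
have h239 : 0 <= 239^-1 :> R by [].
have := atan_ge h5; have := atan_le h5; have := atan_ge h239; have := atan_le h239.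
move: (pi : R) (atan 5^-1) (atan 239^-1) => u v w.
move=> *; apply/andP; lra.
Qed.
End pi_bounds.

(** * Distortion of a set of two points *)

Section two_means.
Context {R : realType}.
Local Notation P := (uniform_disc R).
Implicit Types a b x : plane R.

Lemma enorm_sqr x : enorm x ^+ 2 = x.1 ^+ 2 + x.2 ^+ 2.
Proof. by rewrite sqr_sqrtr// addr_ge0 ?sqr_ge0. Qed.

Let sqdist a x : R := enorm (x - a) ^+ 2.

Let sqdistE a x : sqdist a x = (x.1 - a.1) ^+ 2 + (x.2 - a.2) ^+ 2.
Proof. by rewrite /sqdist enorm_sqr. Qed.

Let sqdist_ge0 a x : 0 <= sqdist a x. Proof. exact: sqr_ge0. Qed.

Let measurable_sqdist a : measurable_fun setT (sqdist a).
Proof.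
rewrite (_ : sqdist a = fun x => (x.1 - a.1) ^+ 2 + (x.2 - a.2) ^+ 2); last first.
  by apply/funext => x; rewrite sqdistE.
by apply: measurable_funD; apply: measurable_funX; apply: measurable_funB.
Qed.

(** Each coordinate axis contributes 1/4 plus the squared coordinate of a. *)
Lemma integral_sqdist a :
  (\int[P]_x (enorm (x - a) ^+ 2)%:E = (1 / 2 + enorm a ^+ 2)%:E)%E.
Proof.
rewrite enorm_sqr.
have e1 : 1 ^+ 2 + 0 ^+ 2 = 1 :> R by rewrite expr1n expr0n addr0.
have e2 : 0 ^+ 2 + 1 ^+ 2 = 1 :> R by rewrite expr1n expr0n add0r.
have E1 := integral_projection_sqr e1 a.1.
have E2 := integral_projection_sqr e2 a.2.
rewrite (_ : 1 / 2 + _ = 1 / 4 + a.1 ^+ 2 + (1 / 4 + a.2 ^+ 2)); last by field.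
rewrite EFinD -E1 -E2 -ge0_integralD//.
- by apply: eq_integral => x _; rewrite -EFinD enorm_sqr mul1r !mul0r addr0 add0r mul1r.
- by move=> x _; rewrite lee_fin sqr_ge0.
- by apply/measurable_EFinP; apply: measurable_funX; apply: measurable_funB => //;
    apply: measurable_funD; exact: measurable_funM.
- by move=> x _; rewrite lee_fin sqr_ge0.
- by apply/measurable_EFinP; apply: measurable_funX; apply: measurable_funB => //;
    apply: measurable_funD; exact: measurable_funM.
Qed.

Lemma distortion_set0 : distortion P set0 = +oo%E.
Proof.
rewrite /distortion; under eq_integral do rewrite image_set0 ereal_inf0.
apply: (etrans (integral_cst P measurableT +oo%E)).
rewrite [X in (_ * X)%E](_ : _ = 1%E) ?mule1//; exact: probability_setT.
Qed.

Lemma distortion_set1 a : distortion P [set a] = (1 / 2 + enorm a ^+ 2)%:E.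
Proof.
rewrite /distortion -integral_sqdist; apply: eq_integral => x _.
by rewrite image_set1 ereal_inf1.
Qed.

Lemma ereal_inf2 (u v : R) : ereal_inf [set u%:E; v%:E] = (Num.min u v)%:E.
Proof.
apply/eqP; rewrite eq_le; apply/andP; split.
  by rewrite /Num.min; case: ifP => _; apply: ereal_inf_lbound; [left|right].
by apply: le_ereal_inf_tmp => _ [->|->]; rewrite lee_fin ge_min lexx ?orbT.
Qed.

Lemma distortion_set2_min a b : distortion P [set a; b] =
  (\int[P]_x (Num.min (enorm (x - a) ^+ 2) (enorm (x - b) ^+ 2))%:E)%E.
Proof.
by apply: eq_integral => x _; rewrite image_setU !image_set1 ereal_inf2.
Qed.

(* |x - a|^2 - |x - b|^2 = 4 (s . d - x . d), where d is the half difference. *)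
Lemma distortion_set2 a b : a <> b ->
  let s := enorm (2^-1 *: (a + b)) in
  let r := enorm (2^-1 *: (a - b)) in
  exists t phi : R, [/\ distortion P [set a; b] =
      (1 / 2 + s ^+ 2 + r ^+ 2 - 2 * r * phi)%:E,
    t ^+ 2 <= s ^+ 2, 0 <= phi, phi <= 4 / (3 * pi) + 2 / pi * t ^+ 2
    & (1 <= `|t| -> phi = `|t|) /\ (t = 0 -> phi = 4 / (3 * pi))].
Proof.
move=> ab s r.
have r2 : r ^+ 2 = (2^-1 * (a.1 - b.1)) ^+ 2 + (2^-1 * (a.2 - b.2)) ^+ 2.
  by rewrite /r enorm_sqr.
have s2 : s ^+ 2 = (2^-1 * (a.1 + b.1)) ^+ 2 + (2^-1 * (a.2 + b.2)) ^+ 2.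
  by rewrite /s enorm_sqr.
have r0 : 0 < r.
  rewrite lt_neqAle sqrtr_ge0 andbT eq_sym; apply/eqP => r0; apply: ab.
  move: r2; rewrite r0 expr0n/= => /esym/eqP.
  rewrite paddr_eq0 ?sqr_ge0// !sqrf_eq0 !mulf_eq0 invr_eq0 pnatr_eq0/= !subr_eq0.
  by move=> /andP[/eqP e1 /eqP e2]; rewrite [a]surjective_pairing e1 e2 -surjective_pairing.
clearbody r s.
(* (p, q) is the unit vector along a - b, and [t] below is the projection of the midpoint (m1, m2)
   on it. *)
pose p := 2^-1 * (a.1 - b.1) / r; pose q := 2^-1 * (a.2 - b.2) / r.
pose m1 := 2^-1 * (a.1 + b.1); pose m2 := 2^-1 * (a.2 + b.2).
pose t := p * m1 + q * m2.
have pq : p ^+ 2 + q ^+ 2 = 1.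
  by rewrite /p /q !expr_div_n -mulrDl -r2 divff// expf_neq0// gt_eqF.
pose N x := `|p * x.1 + q * x.2 - t|.
have mN : measurable_fun setT N.
  apply: measurableT_comp => //; apply: measurable_funB => //.
  by apply: measurable_funD; exact: measurable_funM.
have N0 x : 0 <= N x by exact: normr_ge0.
have [phi phiE] : exists phi : R, (\int[P]_x (N x)%:E = phi%:E)%E.
  exists (fine (\int[P]_x (N x)%:E)%E); rewrite fineK// ge0_fin_numE; last first.
    by apply: integral_ge0 => x _; rewrite lee_fin.
  by apply: le_lt_trans (integral_projection_normB_le pq t) _; rewrite ltry.
exists t, phi; split.
- rewrite distortion_set2_min -/(sqdist a _) -/(sqdist b _).
  (* This is 2 min (u, v) + |u - v| = u + v in additive form, which avoids subtracting extended
     reals. *)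
  have minE x : Num.min (sqdist a x) (sqdist b x) + Num.min (sqdist a x) (sqdist b x)
      + 4 * r * N x = sqdist a x + sqdist b x.
    have : sqdist a x - sqdist b x = 4 * r * (t - (p * x.1 + q * x.2)).
      rewrite !sqdistE /t /p /q /m1 /m2; field; rewrite gt_eqF//.
    have : `|4 * r * (t - (p * x.1 + q * x.2))| = 4 * r * N x.
      rewrite normrM /N distrC (@ger0_norm _ (4 * r))// mulr_ge0// ltW//.
    move=> <- <-; case: (leP (sqdist a x) (sqdist b x)) => h.
      by rewrite ler0_norm ?subr_le0//; lra.
    by rewrite ger0_norm ?subr_ge0// ?ltW//; lra.
  have mmin : measurable_fun setT (fun x => Num.min (sqdist a x) (sqdist b x)).
    exact: measurable_minr.
  have min0 x : 0 <= Num.min (sqdist a x) (sqdist b x) by rewrite le_min !sqdist_ge0.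
  have r40 : 0 <= 4 * r by rewrite mulr_ge0// ltW.
  have EAB : (\int[P]_x ((sqdist a x)%:E + (sqdist b x)%:E) =
      (1 + 2 * s ^+ 2 + 2 * r ^+ 2)%:E)%E.
    rewrite ge0_integralD//; last 4 first.
    - by move=> x _; rewrite lee_fin.
    - exact/measurable_EFinP.
    - by move=> x _; rewrite lee_fin.
    - exact/measurable_EFinP.
    rewrite !integral_sqdist -EFinD s2 r2 !enorm_sqr; congr EFin; by field.
  have Emin : (\int[P]_x ((Num.min (sqdist a x) (sqdist b x))%:E
      + (Num.min (sqdist a x) (sqdist b x))%:E + (4 * r)%:E * (N x)%:E) =
      (1 + 2 * s ^+ 2 + 2 * r ^+ 2)%:E)%E.
    by rewrite -EAB; apply: eq_integral => x _; rewrite -EFinM -!EFinD minE.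
  have mmE : measurable_fun setT (fun x => (Num.min (sqdist a x) (sqdist b x))%:E).
    exact/measurable_EFinP.
  have mNE : measurable_fun setT (fun x => (N x)%:E) by exact/measurable_EFinP.
  move: Emin; rewrite ge0_integralD//; last 4 first.
  - by move=> x _; rewrite adde_ge0// lee_fin.
  - exact: emeasurable_funD.
  - by move=> x _; rewrite mule_ge0// lee_fin.
  - exact: emeasurable_funM.
  rewrite ge0_integralD//; last 2 first.
  - by move=> x _; rewrite lee_fin.
  - by move=> x _; rewrite lee_fin.
  rewrite ge0_integralZl//; last first.
  - by move=> x _; rewrite lee_fin.
  rewrite phiE.
  (* The integral of the minimum is so far an extended real; the equation excludes both
     infinities. *)
  case: (\int[P]_x _)%E => [m||] //.
  move=> [] E; congr EFin; lra.
- rewrite s2 -/m1 -/m2 /t.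
  (* Cauchy-Schwarz by Lagrange's identity: the defect is (p m2 - q m1)^2. *)
  have -> : m1 ^+ 2 + m2 ^+ 2 = (p ^+ 2 + q ^+ 2) * (m1 ^+ 2 + m2 ^+ 2) by rewrite pq mul1r.
  rewrite -subr_ge0 [leRHS](_ : _ = (p * m2 - q * m1) ^+ 2) ?sqr_ge0//; ring.
- by rewrite -lee_fin -phiE; apply: integral_ge0 => x _; rewrite lee_fin.
- by rewrite -lee_fin -phiE; exact: integral_projection_normB_le.
- split=> [t1|t0].
  + apply/eqP; rewrite -eqe -phiE; apply/eqP; exact: integral_projection_normB_ge1.
  + apply/eqP; rewrite -eqe -phiE -(integral_projection_norm pq); apply/eqP.
    by apply: eq_integral => x _; rewrite /N t0 subr0.
Qed.

(** With k = 4 / (3 pi), v - v0 is the sum of s^2 - t^2, (r - phi)^2 and t^2 + k^2 - phi^2. All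
    three are nonnegative, and the last vanishes only at t = 0; equality then forces s = 0 and r =
    phi = k. *)
Lemma two_means_inequality (s r t phi : R) :
  t ^+ 2 <= s ^+ 2 -> 0 <= phi -> phi <= 4 / (3 * pi) + 2 / pi * t ^+ 2 ->
  (1 <= `|t| -> phi = `|t|) ->
  let v := 1 / 2 + s ^+ 2 + r ^+ 2 - 2 * r * phi in
  let v0 := 1 / 2 - 16 / (9 * pi ^+ 2) in
  v0 <= v /\ (v = v0 -> s = 0 /\ r = 4 / (3 * pi)).
Proof.
move=> ts phi0 phile phit v v0.
have [pi3 _] := andP (@pi_bounds R).
have {}pi3 : 31 / 10 < (pi : R) by lra.
have pi0 : 0 < pi :> R by lra.
set k := 4 / (3 * pi) in phile *.
have k0 : 0 < k by rewrite divr_gt0// mulr_gt0.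
have kE : 16 / (9 * pi ^+ 2) = k ^+ 2.
  by rewrite /k; move: (pi : R) pi0 => x x0; field; rewrite gt_eqF.
(* The left side equals 28 / (3 pi^2), so pi > 3 would not suffice but pi > 3.1 does. With c = 2 /
   pi and 0 <= T <= 1 it gives (k + c T)^2 - k^2 - T = T (2 k c + c^2 T - 1) <= 0. *)
have kc : 2 * k * (2 / pi) + (2 / pi) ^+ 2 < 1.
  rewrite (_ : _ + _ = (28 / 3) / pi ^+ 2); last first.
    by rewrite /k; move: (pi : R) pi0 => x x0; field; rewrite gt_eqF.
  by rewrite ltr_pdivrMr ?exprn_gt0//; nra.
set c := 2 / pi in phile kc.
have c0 : 0 < c by rewrite divr_gt0.
clearbody k c.
have tn : `|t| ^+ 2 = t ^+ 2 by rewrite real_normK// num_real.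
(* The quadratic bound on phi is too weak for large |t|, so the exact value phi = |t| is used once
   |t| >= 1, where the inequality is strict. *)
have key : phi ^+ 2 <= t ^+ 2 + k ^+ 2 /\ (phi ^+ 2 = t ^+ 2 + k ^+ 2 -> t ^+ 2 = 0).
  have [t1|t1] := leP 1 `|t|.
    by rewrite phit// tn; split; nra.
  have t2 : 0 <= t ^+ 2 < 1 by rewrite sqr_ge0/= -tn; have := normr_ge0 t; nra.
  move: t2 phile; move: (t ^+ 2) => T /andP[T0 T1] phile.
  have h : phi ^+ 2 <= (k + c * T) ^+ 2 by nra.
  have h2 : T * (2 * k * c + c ^+ 2 * T - 1) <= 0.
    have : c ^+ 2 * T <= c ^+ 2 by nra.
    by nra.
  split; first by nra.
  move=> E; apply/eqP; rewrite eq_le T0 andbT leNgt; apply/negP => Tp.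
  have : T * (2 * k * c + c ^+ 2 * T - 1) < 0.
    have : c ^+ 2 * T <= c ^+ 2 by nra.
    by nra.
  nra.
have [k1 k2] := key.
have vE : v - v0 = (s ^+ 2 - t ^+ 2) + (r - phi) ^+ 2 + (t ^+ 2 + k ^+ 2 - phi ^+ 2).
  by rewrite /v /v0 kE; ring.
have r2 := sqr_ge0 (r - phi).
split; first by rewrite -subr_ge0 vE; lra.
move=> vv; have phiE : phi ^+ 2 = t ^+ 2 + k ^+ 2 by lra.
have t0 := k2 phiE.
have /eqP : s ^+ 2 = 0 by lra.
rewrite sqrf_eq0 => /eqP ->; split=> //.
have /eqP : (r - phi) ^+ 2 = 0 by lra.
rewrite sqrf_eq0 subr_eq0 => /eqP ->.
apply/eqP; rewrite -(@eqrXn2 _ 2)// ?ltW//; lra.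
Qed.
End two_means.

(** * Optimal sets of two means *)

(** An injection of [A] into {0, 1} leaves no room for a third element. *)
Lemma card_le_I2 (T : Type) (A : set T) : A #<= `I_2 ->
  [\/ A = set0, exists a, A = [set a] | exists a b, a <> b /\ A = [set a; b]].
Proof.
move=> /pcard_leP/injfunPex[f funf injf].
have [->|/set0P[a Aa]] := eqVneq A set0; first exact: Or31.
have [Aa1|] := pselect (A `<=` [set a]).
  by apply: Or32; exists a; apply/seteqP; split => // _ ->.
move=> /existsNP[b /not_implyP[Ab ba]]; apply: Or33; exists a, b; split.
  by move=> ab; apply: ba; rewrite ab.
apply/seteqP; split => [c Ac|_ [->|->]//].
have fI x y : A x -> A y -> f x = f y -> x = y.
  by move=> Ax Ay; apply: injf; rewrite inE.
have f2 x : A x -> (f x < 2)%N by move=> Ax; exact: (funf _ Ax).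
have fab : f a <> f b by move=> /(fI _ _ Aa Ab) ab; apply: ba; rewrite ab.
have [/(fI _ _ Ac Aa) ->|ca] := pselect (f c = f a); first by left.
have [/(fI _ _ Ac Ab) ->|cb] := pselect (f c = f b); first by right.
exfalso; move: fab ca cb (f2 _ Aa) (f2 _ Ab) (f2 _ Ac).
by move: (f a) (f b) (f c) => [|[|?]] [|[|?]] [|[|?]].
Qed.

Lemma card_set2_le_I2 (T : Type) (a b : T) : [set a; b] #<= `I_2.
Proof.
rewrite (_ : [set a; b] = (fun i => if i == 0%N then a else b) @` `I_2).
  exact: card_image_le.
apply/seteqP; split=> [_ [->|->]|_ [i _ <-]].
- by exists 0%N.
- by exists 1%N.
- by case: ifP => _; [left|right].
Qed.

(** * The minimal distortion, its minimizers and their uncountability *)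

Section uniform_disc_two_means.
Context {R : realType}.
Local Notation P := (uniform_disc R).
Local Notation k := (4 / (3 * pi) : R).
Local Notation v0 := (1 / 2 - 16 / (9 * pi ^+ 2) : R).

Let pi0 : (pi : R) != 0. Proof. by rewrite gt_eqF// pi_gt0. Qed.

Lemma radius_sqr : k ^+ 2 = 16 / (9 * pi ^+ 2).
Proof. by move: (pi : R) pi0 => x x0; field. Qed.

Lemma radius_gt0 : 0 < k.
Proof. by rewrite divr_gt0// mulr_gt0// pi_gt0. Qed.

Lemma two_means_error_lt : v0 < 1 / 2.
Proof. by have := radius_gt0; rewrite -radius_sqr => k0; nra. Qed.

(** The midpoint is 0, hence t = 0 and phi = k; since also r = k, the distortion is 1/2 + k^2 - 2
    k^2. *)
Lemma distortion_antipodal (a b : plane R) :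
  diameter_ends (16 / (9 * pi ^+ 2)) a b -> distortion P [set a; b] = v0%:E.
Proof.
move=> [Ca Cb ab0].
have bN : b = - a by apply/eqP; rewrite -addr_eq0 addrC ab0.
have ak : enorm a = k.
  apply/eqP; rewrite -(@eqrXn2 _ 2)// ?sqrtr_ge0 ?(ltW radius_gt0)//.
  by rewrite enorm_sqr radius_sqr; apply/eqP.
have ab : a <> b.
  rewrite bN => aN; have := radius_gt0; rewrite -ak.
  have a1 : a.1 = - a.1 by exact: (congr1 fst aN).
  have a2 : a.2 = - a.2 by exact: (congr1 snd aN).
  have N0 (u : R) : u = - u -> u = 0.
    by move=> /eqP; rewrite -addr_eq0 -mulr2n mulrn_eq0 => /eqP.
  by rewrite /enorm (N0 _ a1) (N0 _ a2) expr0n/= addr0 sqrtr0 ltxx.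
have [t [phi [-> ts phi_ge0 _ [_ phi0]]]] := distortion_set2 ab.
rewrite bN subrr scaler0 opprK in ts *.
have s0 : enorm (0 : plane R) = 0 by rewrite /enorm/= expr0n/= addr0 sqrtr0.
rewrite s0 expr0n/= in ts *.
have t0 : t = 0.
  by apply/eqP; rewrite -sqrf_eq0 eq_le ts sqr_ge0.
rewrite (phi0 t0).
have -> : 2^-1 *: (a + a) = a.
  by rewrite scalerDr -scalerDl -[2^-1]mul1r -splitr scale1r.
by rewrite ak -radius_sqr; congr EFin; move: k => x; ring.
Qed.

(** The empty set has infinite distortion and a single point at least 1/2, so only genuine pairs
    compete. *)
Lemma distortion_ge (alpha : set (plane R)) : alpha #<= `I_2 ->
  (v0%:E <= distortion P alpha)%E.
Proof.
move=> /card_le_I2[->|[a ->]|[a [b [ab ->]]]].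
- by rewrite distortion_set0 leey.
- rewrite distortion_set1 lee_fin; have := two_means_error_lt.
  by have := sqr_ge0 (enorm a); lra.
- have [t [phi [-> ts phi0 phile [phi1 _]]]] := distortion_set2 ab.
  rewrite lee_fin.
  by have [] := two_means_inequality (enorm (2^-1 *: (a - b))) ts phi0 phile phi1.
Qed.

(** In the equality case s = 0 makes the points opposite, and r = k puts them on the circle. *)
Lemma distortion_eq (alpha : set (plane R)) : alpha #<= `I_2 ->
  distortion P alpha = v0%:E ->
  exists a b, alpha = [set a; b] /\ diameter_ends (16 / (9 * pi ^+ 2)) a b.
Proof.
move=> /card_le_I2[->|[a ->]|[a [b [ab ->]]]].
- by rewrite distortion_set0.
- rewrite distortion_set1 => -[]; have := two_means_error_lt.
  by have := sqr_ge0 (enorm a); lra.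
- have [t [phi [-> ts phi0 phile [phi1 _]]]] := distortion_set2 ab.
  have [_ H] := two_means_inequality (enorm (2^-1 *: (a - b))) ts phi0 phile phi1.
  move=> -[/H[s0 r0]]; exists a, b; split=> //.
  have : (2^-1 * (a.1 + b.1)) ^+ 2 + (2^-1 * (a.2 + b.2)) ^+ 2 = 0.
    transitivity (enorm (2^-1 *: (a + b)) ^+ 2); first by rewrite enorm_sqr.
    by rewrite s0 expr0n.
  move=> /eqP; rewrite paddr_eq0 ?sqr_ge0// !sqrf_eq0 !mulf_eq0 invr_eq0 pnatr_eq0/=.
  move=> /andP[/eqP e1 /eqP e2].
  have bN : b = - a by apply/eqP; rewrite -addr_eq0 addrC; apply/eqP; congr pair.
  have ak : a.1 ^+ 2 + a.2 ^+ 2 = 16 / (9 * pi ^+ 2).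
    rewrite -radius_sqr -r0 enorm_sqr bN opprK.
    by rewrite scalerDr -scalerDl -[2^-1]mul1r -splitr scale1r.
  by rewrite bN; split; rewrite /circle/= ?sqrrN ?subrr.
Qed.

(** For 0 < t < 1 this runs through the open first-quadrant arc of the circle of radius k. *)
Definition antipodal_point (t : R) : plane R := (k * t, k * Num.sqrt (1 - t ^+ 2)).

Lemma antipodal_point_circle t : 0 < t < 1 ->
  diameter_ends (16 / (9 * pi ^+ 2)) (antipodal_point t) (- antipodal_point t).
Proof.
move=> /andP[t0 t1].
have s2 : Num.sqrt (1 - t ^+ 2) ^+ 2 = 1 - t ^+ 2 by rewrite sqr_sqrtr//; nra.
rewrite /diameter_ends /circle/= subrr !sqrrN !exprMn s2 -radius_sqr.
by split => //; ring.
Qed.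

Lemma quantization_error_uniform_disc : quantization_error P 2 = v0%:E.
Proof.
apply/eqP; rewrite eq_le; apply/andP; split; last first.
  by apply: le_ereal_inf_tmp => _ [alpha alpha2 <-]; exact: distortion_ge.
have t01 : 0 < (2^-1 : R) < 1 by rewrite invr_gt0 invf_lt1 ?ltr1n ?ltr0n.
apply: ereal_inf_lbound.
exists [set antipodal_point 2^-1; - antipodal_point 2^-1].
  exact: card_set2_le_I2.
by apply: distortion_antipodal; exact: antipodal_point_circle.
Qed.

(** Distinct t in ]0, 1[ give distinct optimal pairs; were these countable, ]0, 1[ would have
    Lebesgue measure 0 instead of 1. *)
Lemma uncountable_optimal_two_means : ~ countable [set alpha | optimal_means P 2 alpha].
Proof.
pose A t : set (plane R) := [set antipodal_point t; - antipodal_point t].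
move=> opt_countable.
have AI : A @` `]0, 1[ `<=` [set alpha | optimal_means P 2 alpha].
  move=> _ [t/= + <-]; rewrite in_itv/= => t01; split; first exact: card_set2_le_I2.
  rewrite quantization_error_uniform_disc.
  by apply: distortion_antipodal; exact: antipodal_point_circle.
have injA : {in `]0, 1[%classic &, injective A}.
  move=> t u; rewrite !inE/= !in_itv/= => /andP[t0 t1] /andP[u0 u1] Atu.
  have : A u (antipodal_point t) by rewrite -Atu; left.
  have k0 := radius_gt0.
  move=> [[/(mulfI (lt0r_neq0 k0)) -> //]|[]].
  (* The point of parameter t cannot be the antipode of that of parameter u: first coordinates on
     the arc are positive. *)
  move=> E; have := mulr_gt0 k0 t0; have := mulr_gt0 k0 u0; lra.
have := sub_countable (subset_card_le AI) opt_countable.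
rewrite (eq_countable (inj_card_eq injA)) => /countable_lebesgue_measure0.
rewrite lebesgue_measure_itv/= lte_fin ltr01 => -[]; lra.
Qed.

End uniform_disc_two_means.
Theorem theorem2p7p1 (R : realType)
    (half_discs : forall alpha : set (plane R),
      optimal_means (uniform_disc R) 2 alpha ->
      forall a b : plane R, a <> b -> alpha = [set a; b] ->
      exists p q : plane R,
        [/\ diameter_ends 1 p q,
            voronoi a alpha `&` disc = half_disc p q
          & voronoi b alpha `&` disc = half_disc q p]) :
  [/\ ~ countable [set alpha | optimal_means (uniform_disc R) 2 alpha],
      (`|quantization_error (uniform_disc R) 2 - (319 / 10 ^+ 3 + 873 / 10 ^+ 6)%:E|
         < (10 ^- 6)%:E)%E
    & forall alpha : set (plane R), optimal_means (uniform_disc R) 2 alpha ->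
      exists a b : plane R,
        alpha = [set a; b] /\ diameter_ends (16 / (9 * pi ^+ 2)) a b].

Proof.
split.
- exact: uncountable_optimal_two_means.
- rewrite quantization_error_uniform_disc -EFinB abse_EFin lte_fin.
  have /andP[pi1 pi2] := @pi_bounds R.
  have p0 : 0 < (pi : R) by exact: pi_gt0.
  have X0 : 0 < 9 * (pi : R) ^+ 2 by rewrite mulr_gt0// exprn_gt0.
  (* Since 1/2 - 0.319873 = 0.180127, the claim is that 16 / (9 pi^2) lies within 10^-6 of
     0.180127. *)
  have lo : 180 / 10 ^+ 3 + 126 / 10 ^+ 6 < 16 / (9 * pi ^+ 2) :> R.
    by rewrite ltr_pdivlMr//; nra.
  have hi : 16 / (9 * pi ^+ 2) < 180 / 10 ^+ 3 + 128 / 10 ^+ 6 :> R.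
    by rewrite ltr_pdivrMr//; nra.
  by rewrite ltr_norml; apply/andP; lra.
- move=> alpha [alpha2]; rewrite quantization_error_uniform_disc; exact: distortion_eq.
Qed.
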